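(* There exist $2^{\aleph_0}$ path-minimal non-prime graphs whose ages are pairwise incomparable with respect to set inclusion and each well-quasi-ordered under embeddability, and such that every graph equimorphic to any of these graphs is also non-prime.
   Context: Graphs are simple, undirected, loopless. A graph embeds in another if it is isomorphic to an induced subgraph; two graphs are equimorphic if each embeds in the other. The age of a graph is the class of finite graphs embedding in it; it is well-quasi-ordered if it contains no infinite antichain. A path is a graph whose vertices can be injectively mapped into an interval of $\mathbb{Z}$ so that adjacency means images differing by $1$; its length is its number of vertices minus one. A graph $G$ is path-minimal if for every $n$ it has an induced subgraph which is a finite path of length at least $n$, and every induced subgraph of $G$ with this property embeds $G$. A module of $G=(V,E)$ is a set $A\subseteq V$ such that every $v\notin A$ is adjacent to all or to none of the vertices of $A$; $\emptyset$, singletons and $V$ are trivial modules. $G$ is prime if it has more than three vertices and all its modules are trivial. *)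

(* Defs.v *)
From mathcomp Require Import all_boot all_order all_algebra.
From mathcomp Require Import boolp classical_sets functions cardinality.

Set Implicit Arguments.
Unset Strict Implicit.
Unset Printing Implicit Defensive.

Import Order.TTheory GRing.Theory Num.Theory.

Local Open Scope classical_set_scope.
Local Open Scope card_scope.
Local Open Scope ring_scope.

Record graph := Graph {
  vertex : Type;
  adj : vertex -> vertex -> Prop;
  adj_sym : forall x y, adj x y -> adj y x;
  adj_irr : forall x, ~ adj x x }.

Definition induced (G : graph) (A : set (vertex G)) : graph :=
  @Graph {x : vertex G | A x}
    (fun x y => adj (sval x) (sval y))
    (fun x y => @adj_sym G (sval x) (sval y))
    (fun x => @adj_irr G (sval x)).

Definition isomorphic (G H : graph) : Prop :=
  exists f : vertex G -> vertex H,
    bijective f /\ forall x y, adj x y <-> adj (f x) (f y).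

Definition embeds (H G : graph) : Prop :=
  exists A : set (vertex G), isomorphic H (induced A).

Definition equimorphic (G H : graph) : Prop := embeds G H /\ embeds H G.

Definition finite_graph (G : graph) : Prop := finite_set [set: vertex G].

Definition age (G : graph) : set graph :=
  [set H | finite_graph H /\ embeds H G].

Definition antichain (C : set graph) : Prop :=
  forall G H, C G -> C H -> G <> H -> ~ embeds G H.

Definition well_quasi_ordered (C : set graph) : Prop :=
  ~ exists A : set graph, [/\ A `<=` C, infinite_set A & antichain A].

Definition int_interval (I : set int) : Prop :=
  forall a b c : int, I a -> I c -> a <= b <= c -> I b.

(* The vertices must fill the whole interval: with a map merely into an
   interval, edgeless graphs would count as paths. *)
Definition is_path (P : graph) : Prop :=
  exists (I : set int) (f : vertex P -> int),
    [/\ int_interval I, injective f, range f = I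
      & forall x y, adj x y <-> `|f x - f y| = 1 :> int].

(* Length is the number of vertices minus one; `I_l.+1 is a set of
   cardinality l + 1. *)
Definition is_path_of_length (P : graph) (l : nat) : Prop :=
  is_path P /\ [set: vertex P] #= `I_l.+1.

Definition has_unbounded_paths (G : graph) : Prop :=
  forall n : nat, exists (A : set (vertex G)) (l : nat),
    (n <= l)%N /\ is_path_of_length (induced A) l.

Definition path_minimal (G : graph) : Prop :=
  has_unbounded_paths G /\
  forall A : set (vertex G),
    has_unbounded_paths (induced A) -> embeds G (induced A).

Definition is_module (G : graph) (A : set (vertex G)) : Prop :=
  forall v, ~ A v ->
    (forall a, A a -> adj v a) \/ (forall a, A a -> ~ adj v a).

Definition trivial_module (G : graph) (A : set (vertex G)) : Prop :=
  [\/ A = set0, (exists x, A = [set x]) | A = [set: vertex G]].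

Definition prime_graph (G : graph) : Prop :=
  `I_4 #<= [set: vertex G] /\
  forall A : set (vertex G), is_module A -> trivial_module A.

(* Main.v *)
(** For a binary word w, take disjoint finite paths of every length, the x-th
    vertex of each carrying the letter w x, and join each vertex carrying the
    letter 1 to all vertices of all longer paths. The vertices lying in the paths
    beyond a given length form a module, in this graph and in every graph
    equimorphic to it, so none of them is prime.

    An induced path meeting several of the given paths has at most two vertices
    outside the shortest of these, so long induced paths contain long intervals
    of the given paths. When w is uniformly recurrent each such interval contains
    any prescribed prefix of w, whence path-minimality; moreover the factors of w
    have no infinite antichain, and Higman's lemma, applied within the paths and
    then to the sequence of paths, shows that the age is well-quasi-ordered.

    The age determines the factors of w up to reversal. For the Toeplitz words
    w x = s (v_2 (x + 1)), which are uniformly recurrent and whose sets of factors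
    are closed under reversal, these factors determine s as soon as s has no three
    equal consecutive values. *)

Require Import Defs.
From mathcomp Require Import all_boot all_order ssralg ssrnum ssrint zify.
From mathcomp Require Import boolp classical_sets functions cardinality.

Set Implicit Arguments.
Unset Strict Implicit.
Unset Printing Implicit Defensive.

Local Open Scope classical_set_scope.
Local Open Scope card_scope.

(** * Embeddings and induced paths *)

Lemma sval_injective (T : Type) (P : T -> Prop) : injective (@sval T P).
Proof. by move=> [x px] [y py] /=; exact: eq_exist. Qed.

Lemma embedsP (H G : graph) :
  embeds H G <-> exists2 f : vertex H -> vertex G,
    injective f & forall x y, adj x y <-> adj (f x) (f y).
Proof.
split=> [[A [f [f_bij f_adj]]]|[f f_inj f_adj]].
  exists (sval \o f) => [|x y]; last exact: f_adj.
  exact: inj_comp (@sval_injective _ _) (bij_inj f_bij).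
exists (range f).
have inv_ex (y : vertex (induced (range f))) : exists x, f x = sval y.
  by case: y => y [x ? fx]; exists x.
have [g gE] := choice inv_ex.
exists (fun x => exist _ (f x) (ex_intro2 _ _ x I erefl)); split=> //.
exists g => [x|y]; first by apply: f_inj; rewrite gE.
by apply: sval_injective; rewrite /= gE.
Qed.

(** Indexing by all of [nat], with constraints only up to [l], avoids dependent types. *)
Definition induced_path (G : graph) (l : nat) (q : nat -> vertex G) : Prop :=
  (forall i j, i <= l -> j <= l -> q i = q j -> i = j) /\
  (forall i j, i <= l -> j <= l ->
     (adj (q i) (q j) <-> i = j.+1 \/ j = i.+1)).

Lemma induced_path_embed (H G : graph) (l : nat) (q : nat -> vertex H)
    (f : vertex H -> vertex G) :
  injective f -> (forall x y, adj x y <-> adj (f x) (f y)) ->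
  induced_path l q -> induced_path l (f \o q).
Proof.
move=> f_inj f_adj [q_inj q_adj]; split=> i j il jl; first by move/f_inj; exact: q_inj.
by rewrite -q_adj // f_adj.
Qed.

Lemma is_path_of_length_range (G : graph) (l : nat) (q : nat -> vertex G) :
  induced_path l q -> is_path_of_length (induced (q @` `I_l.+1)) l.
Proof.
move=> [q_inj q_adj]; set A := q @` _.
have idx_ex (y : vertex (induced A)) : exists i, i <= l /\ q i = sval y.
  by case: y => y [i /= ? qi]; exists i.
have [g gE] := choice idx_ex.
have gl y : g y <= l by have [] := gE y.
have qg y : q (g y) = sval y by have [] := gE y.
have g_inj : injective g.
  by move=> x y gxy; apply: sval_injective; rewrite -!qg gxy.
have g_surj i : i <= l -> exists y, g y = i.
  move=> il; have Aqi : A (q i) by exists i.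
  by exists (exist _ (q i) Aqi); apply: q_inj => //; rewrite qg.
split.
  exists [set z : int | exists2 i, i <= l & z = Posz i], (fun y => Posz (g y)); split.
  - move=> a b c [i il ->] [j jl ->] /andP[ab bc].
    by exists `|b|%N; lia.
  - by move=> x y [] /g_inj.
  - apply/seteqP; split=> z /=; first by move=> [y _ <-]; exists (g y).
    by move=> [i /g_surj[y <-] ->]; exists y.
  - move=> x y; have -> : adj x y <-> adj (q (g x)) (q (g y)) by rewrite !qg.
    by rewrite q_adj //; lia.
apply/card_set_bijP; exists g; split.
- by move=> y _ /=; rewrite ltnS.
- by move=> x y _ _ /g_inj.
- by move=> i /=; rewrite ltnS => /g_surj[y <-]; exists y.
Qed.

Lemma is_path_of_length_seq (G : graph) (l : nat) :
  is_path_of_length G l -> exists q : nat -> vertex G, induced_path l q.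
Proof.
move=> [[I [f [I_int f_inj fI f_adj]]] /card_esym cardG].
have [e e_inj e_surj] : exists2 e : 'I_l.+1 -> vertex G,
    injective e & forall x, exists i, e i = x.
  have [g [h gK hK]] := card_bijP cardG.
  have inI (i : 'I_l.+1) : nat_of_ord i \in `I_l.+1 by rewrite inE /=.
  exists (fun i => set_val (g (SigSub (inI i)))).
    move=> i j /val_inj/(can_inj gK) /(congr1 val) /= ij; exact: val_inj.
  move=> x; have xT : x \in [set: vertex G] by rewrite inE.
  have := set_valP (h (SigSub xT)) => /= hl.
  exists (Ordinal hl); rewrite (_ : SigSub _ = h (SigSub xT)) ?hK //.
  exact: val_inj.
have [m _ m_min] := @Order.TotalTheory.arg_minP _ _ _ (@ord0 l) xpredT (fun i => f (e i)) isT.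
set a := f (e m) in m_min.
have Ia : I a by rewrite -fI; exists (e m).
have I_ge z : I z -> (a <= z)%R.
  by rewrite -fI => -[x _ <-]; have [i <-] := e_surj x; exact: m_min.
(* Pigeonhole: the image is an interval with minimum [a], so a gap at [a + i] would squeeze [l + 1]
   distinct values into the [i <= l] places below it. *)
have I_all i : i <= l -> I (a + Posz i)%R.
  move=> il; apply: contrapT => NI.
  have I_lt z : I z -> (z < a + Posz i)%R.
    move=> Iz; rewrite Order.TotalTheory.ltNge; apply/negP => az.
    by apply: NI; apply: (I_int a _ z) => //; lia.
  have bnd (k : 'I_l.+1) : `|f (e k) - a|%N < i.
    have If : I (f (e k)) by rewrite -fI; exists (e k).
    by have := I_ge _ If; have := I_lt _ If; lia.
  have : #|'I_l.+1| <= #|'I_i|.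
    apply: (@leq_card _ _ (fun k => Ordinal (bnd k))) => k k' [].
    move=> ekk'; apply/e_inj/f_inj.
    have If : I (f (e k)) by rewrite -fI; exists (e k).
    have If' : I (f (e k')) by rewrite -fI; exists (e k').
    by have := I_ge _ If; have := I_ge _ If'; lia.
  by rewrite !card_ord; lia.
have q_ex i : exists x, i <= l -> f x = (a + Posz i)%R.
  have [il|_] := leqP i l; last by exists (e ord0).
  by have := I_all i il; rewrite -fI => -[x _ fx]; exists x.
have [q qE] := choice q_ex.
exists q; split=> i j il jl.
  by move=> /(congr1 f); rewrite !qE //; lia.
by rewrite f_adj !qE //; lia.
Qed.

Lemma has_unbounded_pathsP (G : graph) :
  has_unbounded_paths G <-> forall n, exists q, @induced_path G n q.
Proof.
split=> [pG n|pG n].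
  have [A [l [nl /is_path_of_length_seq[q q_path]]]] := pG n.
  have [q_inj q_adj] :=
    @induced_path_embed (induced A) G l q sval (@sval_injective _ A)
      (fun _ _ => iff_refl _) q_path.
  exists (fun i => sval (q i)); split=> i j il jl.
    by apply: q_inj; exact: leq_trans nl.
  by apply: q_adj; exact: leq_trans nl.
have [q /is_path_of_length_range pq] := pG n.
by exists (q @` `I_n.+1), n.
Qed.

(** * Well-quasi-orders and Higman's lemma *)

Definition wqo (T : Type) (R : T -> T -> Prop) : Prop :=
  forall f : nat -> T, exists i j, i < j /\ R (f i) (f j).

Lemma ltn_step_homo (g : nat -> nat) :
  (forall k, g k < g k.+1) -> {homo g : i j / i < j}.
Proof. by move=> g_lt; apply: (homo_ltn ltn_trans). Qed.

(** Only finitely many terms lack a later term above them, since infinitely many would form a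
    sequence refuting [wqo]. Beyond these a chain is built step by step. *)
Lemma wqo_increasing (T : Type) (R : T -> T -> Prop) :
  (forall x y z, R x y -> R y z -> R x z) -> wqo R ->
  forall f : nat -> T, exists2 g : nat -> nat,
    {homo g : i j / i < j} & forall i j, i < j -> R (f (g i)) (f (g j)).
Proof.
move=> R_tr R_wqo f.
have [N N_ok] : exists N, forall n, N <= n -> exists m, n < m /\ R (f n) (f m).
  apply: contrapT => /forallNP no_N.
  have term_ex N : exists n, N <= n /\ forall m, n < m -> ~ R (f n) (f m).
    have /existsNP[n /not_implyP[Nn]] := no_N N.
    by move=> /forallNP n_max; exists n; split=> // m nm Rnm; apply: (n_max m).
  have [h hE] := choice term_ex.
  pose g := fix g k := if k is k'.+1 then h (g k').+1 else h 0.
  have g_homo : {homo g : i j / i < j}.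
    by apply: ltn_step_homo => k; have [] := hE (g k).+1.
  have g_max k m : g k < m -> ~ R (f (g k)) (f m).
    by case: k => [|k]; [have [_] := hE 0 | have [_] := hE (g k).+1]; apply.
  have [i [j [ij]]] := R_wqo (f \o g).
  by apply: g_max; exact: g_homo.
have next_ex n : exists m, N <= n -> n < m /\ R (f n) (f m).
  have [/N_ok[m ?]|] := leqP N n; first by exists m.
  by exists 0.
have [h hE] := choice next_ex.
pose g k := iter k h N.
have gN k : N <= g k.
  by elim: k => //= k IHk; have [/ltnW + _] := hE _ IHk; exact: leq_trans.
exists g; first by apply: ltn_step_homo => k; have [] := hE _ (gN k).
move=> i j; elim: j => // j IHj; rewrite ltnS leq_eqVlt => /predU1P[->|ij].
  by have [] := hE _ (gN j).
by apply: R_tr (IHj ij) _; have [] := hE _ (gN j).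
Qed.

Lemma minimal_exists (T : Type) (m : T -> nat) (P : T -> Prop) (x : T) :
  P x -> exists2 y, P y & forall z, P z -> m y <= m z.
Proof.
move=> Px; pose Q := [pred n | `[< exists2 y, P y & m y = n >]].
have exQ : exists n, Q n by exists (m x); apply/asboolP; exists x.
have [n /asboolP[y Py <-] n_min] := ex_minnP exQ.
by exists y => // z Pz; apply: n_min; apply/asboolP; exists z.
Qed.

Definition word_embeds (T : Type) (R : T -> T -> Prop) (s t : seq T) : Prop :=
  exists2 g : nat -> nat, {homo g : i j / i < j} &
    forall x0 i, i < size s ->
      g i < size t /\ R (nth x0 s i) (nth x0 t (g i)).

Section Higman.
Variables (T : Type) (R : T -> T -> Prop).

Lemma word_embeds_nil t : word_embeds R [::] t.
Proof. by exists id. Qed.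

Lemma word_embeds_behead s b t : word_embeds R s t -> word_embeds R s (b :: t).
Proof.
move=> [g g_homo gR]; exists (fun i => (g i).+1) => [i j /g_homo //|x0 i /(gR x0)].
by [].
Qed.

Lemma word_embeds_cons a s b t :
  R a b -> word_embeds R s t -> word_embeds R (a :: s) (b :: t).
Proof.
move=> Rab [g g_homo gR].
exists (fun i => if i is i'.+1 then (g i').+1 else 0) => [[|i] [|j] //|x0 [|i] //].
  by rewrite !ltnS; exact: g_homo.
exact: gR.
Qed.

Hypothesis R_trans : forall x y z, R x y -> R y z -> R x z.

Lemma word_embeds_trans s t u :
  word_embeds R s t -> word_embeds R t u -> word_embeds R s u.
Proof.
move=> [g g_homo gR] [h h_homo hR]; exists (h \o g).
  by move=> i j ij; apply/h_homo/g_homo.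
move=> x0 i /(gR x0)[/(hR x0)[hgu R2] R1]; split=> //.
exact: R_trans R1 R2.
Qed.

Let bad (f : nat -> seq T) := forall i j, i < j -> ~ word_embeds R (f i) (f j).

(** Nash-Williams' construction: [F n] keeps the previous bad sequence below [n] and makes the
    [n]-th term as short as possible. The diagonal is bad because later sequences agree with [F n]
    up to [n]. *)
Lemma minimal_bad_sequence f : bad f -> exists2 g, bad g &
  forall n h, bad h -> (forall i, i < n -> h i = g i) -> size (g n) <= size (h n).
Proof.
move=> f_bad.
have mb_ex (nf : nat * (nat -> seq T)) : exists f', bad nf.2 ->
    [/\ bad f', forall i, i < nf.1 -> f' i = nf.2 i &
     forall h, bad h -> (forall i, i < nf.1 -> h i = nf.2 i) ->
       size (f' nf.1) <= size (h nf.1)].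
  case: nf => n f0 /=; have [f0_bad|] := pselect (bad f0); last by exists f0.
  have [|f' [? ?] f'_min] := @minimal_exists _ (fun h => size (h n))
    (fun h => bad h /\ forall i, i < n -> h i = f0 i) f0; first by [].
  by exists f' => _; split=> // h ? ?; apply: f'_min.
have [mb mbE] := choice mb_ex.
pose F := fix F n := mb (n, if n is n'.+1 then F n' else f).
have F_bad n : bad (F n).
  by elim: n => [|n IHn]; [have [] := mbE (0, f) f_bad | have [] := mbE (n.+1, F n) IHn].
have F_agree n k i : i <= n -> F (n + k) i = F n i.
  move=> le_in; elim: k => [|k IHk]; first by rewrite addn0.
  rewrite addnS -IHk; have [_ + _] := mbE ((n + k).+1, F (n + k)) (F_bad _).
  by apply; rewrite /= ltnS (leq_trans le_in) ?leq_addr.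
have F_diag i n : i <= n -> F n i = F i i.
  by move=> le_in; rewrite -[n](subnKC le_in) F_agree.
exists (fun n => F n n).
  move=> i j ij; rewrite -(F_diag i j (ltnW ij)); exact: F_bad.
move=> [|n] h h_bad h_agree.
  by have [_ _ /=] := mbE (0, f) f_bad; apply.
have [_ _ /=] := mbE (n.+1, F n) (F_bad n); apply=> // i lt_in.
by rewrite h_agree // F_diag.
Qed.

Lemma higman : wqo R -> wqo (word_embeds R).
Proof.
move=> R_wqo f; apply: contrapT => f_good.
have f_bad : bad f by move=> i j ij fij; apply: f_good; exists i, j.
have [g g_bad g_min] := minimal_bad_sequence f_bad.
have at_ex n : exists p : T * seq T, g n = p.1 :: p.2.
  case gE: (g n) => [|a t]; last by exists (a, t).
  by have := g_bad n n.+1 (ltnSn n); rewrite gE; case; exact: word_embeds_nil.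
have [at_ atE] := choice at_ex.
have [h h_homo hR] := wqo_increasing R_trans R_wqo (fun n => (at_ n).1).
(* [g'] follows [g] up to [h 0] and continues with the tails of [g (h 0)], [g (h 1)] and so on,
   whose heads increase. It is again bad, but its term at [h 0] is too short. *)
pose k i := h (i - h 0).
have h_ge i : h 0 <= h i by case: i => // i; exact/ltnW/h_homo.
pose g' i := if i < h 0 then g i else (at_ (k i)).2.
have g'_bad : bad g'.
  move=> i j ij; rewrite /g'.
  case: (ltnP i (h 0)) => hi; case: (ltnP j (h 0)) => hj.
  - exact: g_bad.
  - move=> gt; apply: (g_bad i (k j)); first exact: leq_trans hi (h_ge _).
    by rewrite [g (k j)]atE; exact: word_embeds_behead.
  - by lia.
  - have lt_ij : i - h 0 < j - h 0 by lia.
    move=> tt; apply: (g_bad (k i) (k j)); first exact: h_homo.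
    by rewrite !atE; apply: word_embeds_cons => //; exact: hR.
have := g_min (h 0) g' g'_bad.
rewrite {2}/g' ltnn /k subnn {1}atE /= ltnn => /(_ _)/negP; apply => //.
by move=> i hi; rewrite /g' hi.
Qed.

End Higman.

(** * Toeplitz words and their factors *)

Definition toeplitz (s : nat -> bool) (x : nat) : bool := s (logn 2 x.+1).

Lemma logn2_double n : 0 < n -> logn 2 n.*2 = (logn 2 n).+1.
Proof. by move=> n_gt0; rewrite -mul2n lognM // logn_prime. Qed.

Lemma logn2_odd n : odd n -> logn 2 n = 0.
Proof. by move=> n_odd; rewrite lognE dvdn2 n_odd andbF. Qed.

Lemma logn2_addn k a r : 0 < r < 2 ^ k -> logn 2 (a * 2 ^ k + r) = logn 2 r.
Proof.
elim: k r => [|k IHk] r; first by rewrite expn0; lia.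
rewrite expnS => r_bnd; case: (boolP (odd r)) => r_odd.
  by rewrite !logn2_odd //; lia.
rewrite -(even_halfK r_odd) (_ : _ + _ = (a * 2 ^ k + r./2).*2); last by lia.
by rewrite !logn2_double ?IHk //; lia.
Qed.

Lemma logn2_subn k r : 0 < r < 2 ^ k -> logn 2 (2 ^ k - r) = logn 2 r.
Proof.
elim: k r => [|k IHk] r; first by rewrite expn0; lia.
rewrite expnS => r_bnd; case: (boolP (odd r)) => r_odd.
  by rewrite !logn2_odd //; lia.
rewrite -(even_halfK r_odd) (_ : _ - _ = (2 ^ k - r./2).*2); last by lia.
by rewrite !logn2_double ?IHk //; lia.
Qed.

Lemma toeplitz_recurrent s k a x :
  x.+1 < 2 ^ k -> toeplitz s (a * 2 ^ k + x) = toeplitz s x.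
Proof. by move=> xk; rewrite /toeplitz -addnS logn2_addn. Qed.

Lemma toeplitz_rev s k x :
  x.+1 < 2 ^ k -> toeplitz s (2 ^ k - x.+2) = toeplitz s x.
Proof.
move=> xk; rewrite /toeplitz -(@logn2_subn k x.+1) //.
by congr (s (logn 2 _)); lia.
Qed.

Lemma toeplitz_window s N : exists M, forall b, exists2 o,
  o + N <= M & forall n, n < N -> toeplitz s (b + o + n) = toeplitz s n.
Proof.
exists (2 ^ N + N) => b.
have e_gt0 : 0 < 2 ^ N by rewrite expn_gt0.
have := divn_eq b (2 ^ N); have := ltn_pmod b e_gt0.
set q := b %/ _; set r := b %% _ => r_lt bE.
(* [b + o] is the first multiple of [2 ^ N] beyond [b], and the first [N] letters recur at all such
   multiples. *)
exists (2 ^ N - r); first by rewrite leq_add2r leq_subr.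
move=> n nN; rewrite -(@toeplitz_recurrent s N q.+1 n).
  by congr toeplitz; rewrite mulSn; lia.
by apply: leq_ltn_trans nN _; exact: ltn_expl.
Qed.

(* Excluding three equal consecutive values makes the parities of two positions
   carrying the same long factor agree, whatever the shift of [s]. *)
Definition no_triple (s : nat -> bool) : Prop :=
  forall k, ~ (s k = s k.+1 /\ s k.+1 = s k.+2).

(** Both letters occur among [s 0], [s 1], [s 2], and the numbers congruent to 1, 2, 4 modulo 8 have
    valuation 0, 1, 2. *)
Lemma toeplitz_value s b c : no_triple s ->
  exists2 n, n < 8 & forall i, toeplitz s (c + n + 8 * i) = b.
Proof.
move=> s_nt.
have [r [l [r_lt r_log sl]]] : exists r l, [/\ 0 < r < 8, logn 2 r = l & s l = b].
  have := s_nt 0; case: (eqVneq (s 0) b) => [|s0]; first by exists 1, 0.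
  case: (eqVneq (s 1) b) => [|s1]; first by exists 2, 1.
  case: (eqVneq (s 2) b) => [|s2]; first by exists 4, 2.
  by move: s0 s1 s2; case: b; case: (s 0); case: (s 1); case: (s 2) => //= _ _ _ [].
exists ((8 + r - c.+1 %% 8) %% 8); first by rewrite ltn_mod.
move=> i; rewrite /toeplitz.
set n := _ %% _ in |- *.
have -> : (c + n + 8 * i).+1 = (c.+1 + n) %/ 8 * 2 ^ 3 + i * 2 ^ 3 + r.
  by rewrite /n; lia.
by rewrite -mulnDl logn2_addn // r_log.
Qed.

(** If the parities differed, odd numbers [A + m], all giving [s' 0], would face the numbers [C + m]
    congruent to 2, 4, 8 modulo 16, so [s 1], [s 2], [s 3] would be equal. *)
Lemma toeplitz_factor_step s s' A C L : no_triple s -> 0 < A -> 0 < C ->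
  16 <= L ->
  (forall m, m <= L -> s' (logn 2 (A + m)) = s (logn 2 (C + m))) ->
  odd A = odd C /\ s' 0 = s 0.
Proof.
move=> s_nt A_gt0 C_gt0 L16 sE.
case: (eqVneq (odd A) (odd C)) => parAC.
  (* [m] is 0 or 1, whichever makes both sums odd. *)
  split=> //; have := sE (~~ odd A).
  by rewrite !logn2_odd; [apply; lia | lia | lia].
have val l r : 0 < r < 16 -> logn 2 r = l.+1 -> s l.+1 = s' 0.
  move=> r_lt r_log; pose m := (16 + r - C %% 16) %% 16.
  have r_even : ~~ odd r by apply/negP => /logn2_odd; rewrite r_log.
  have := sE m; rewrite logn2_odd; last by rewrite /m; lia.
  have -> : C + m = (C + m) %/ 16 * 2 ^ 4 + r by rewrite /m; lia.
  by rewrite logn2_addn // r_log => -> //; rewrite /m; lia.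
case: (s_nt 1); rewrite (val 0 2) // (val 1 4) // (val 2 8) //.
Qed.

(** Since parities agree, restricting both windows to even numbers and halving passes from [s] and
    [s'] to their shifts. *)
Lemma toeplitz_factors_inj s s' : no_triple s ->
  (forall L, exists A C, [/\ 0 < A, 0 < C &
     forall m, m <= L -> s' (logn 2 (A + m)) = s (logn 2 (C + m))]) ->
  s' =1 s.
Proof.
move=> + + j; elim: j s s' => [|j IHj] s s' s_nt s_fact.
  have [A [C [A_gt0 C_gt0 sE]]] := s_fact 16.
  by have [] := toeplitz_factor_step s_nt A_gt0 C_gt0 (leqnn 16) sE.
apply: (IHj (s \o S) (s' \o S)) => [k|L]; first exact: s_nt.
have [A [C [A_gt0 C_gt0 sE]]] := s_fact (L.*2 + 16).
have [parAC _] := toeplitz_factor_step s_nt A_gt0 C_gt0 (leq_addl _ _) sE.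
exists (uphalf A), (uphalf C); split; rewrite ?uphalf_gt0 // => m mL.
have := sE (odd A + m.*2).
rewrite (_ : A + _ = (uphalf A + m).*2); last by lia.
rewrite (_ : C + _ = (uphalf C + m).*2); last by lia.
by rewrite !logn2_double /=; [apply; lia | lia | lia].
Qed.

(** Each value is followed by its negation, so three consecutive terms always contain a
    complementary pair, and [t] is read off at even indices. *)
Definition interleave_neg (t : nat -> bool) (n : nat) : bool := odd n (+) t n./2.

Lemma no_triple_interleave_neg t : no_triple (interleave_neg t).
Proof.
move=> k []; rewrite /interleave_neg.
case: (boolP (odd k)) => k_odd.
  have -> : k.+2./2 = k.+1./2 by lia.
  by rewrite !oddS k_odd => _; case: (t _).
have -> : k.+1./2 = k./2 by lia.
by rewrite !oddS (negbTE k_odd) => + _; case: (t _).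
Qed.

Lemma interleave_neg_inj t t' : interleave_neg t =1 interleave_neg t' -> t = t'.
Proof.
by move=> e; apply/funext => k; have := e k.*2; rewrite /interleave_neg odd_double doubleK.
Qed.

(** * The graph of a word *)

Definition row_adj (w : nat -> bool) (p q : nat * nat) : bool :=
  if p.1 == q.1 then (p.2 == q.2.+1) || (q.2 == p.2.+1)
  else if p.1 < q.1 then w p.2 else w q.2.

Lemma row_adj_sym w p q : row_adj w p q -> row_adj w q p.
Proof.
by rewrite /row_adj eq_sym orbC; case: ifP => //; case: ltngtP.
Qed.

Lemma row_adj_irr w p : ~ row_adj w p p.
Proof. by rewrite /row_adj eqxx; lia. Qed.

Lemma row_adj_map w w' p q p' q' :
  (p.1 < q.1) = (p'.1 < q'.1) -> (q.1 < p.1) = (q'.1 < p'.1) ->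
  w p.2 = w' p'.2 -> w q.2 = w' q'.2 ->
  (p.1 = q.1 -> (p.2 = q.2.+1 <-> p'.2 = q'.2.+1)) ->
  (p.1 = q.1 -> (q.2 = p.2.+1 <-> q'.2 = p'.2.+1)) ->
  row_adj w p q = row_adj w' p' q'.
Proof.
rewrite /row_adj => lt_pq lt_qp -> -> eq1 eq2; rewrite -lt_pq.
have -> : (p'.1 == q'.1) = (p.1 == q.1) by lia.
by case: eqP => // pq; have := eq1 pq; have := eq2 pq; lia.
Qed.

(* Vertex [(i, x)] is the [x]-th vertex of the [i]-th path, which has [i]
   vertices; a letter [w x = true] joins it to all paths of larger index. *)
Definition stair (w : nat -> bool) : graph :=
  @Graph {p : nat * nat | p.2 < p.1}
    (fun u v => row_adj w (sval u) (sval v))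
    (fun u v => @row_adj_sym w (sval u) (sval v))
    (fun u => @row_adj_irr w (sval u)).

Lemma cell_proof i x : (i.+1, minn x i).2 < (i.+1, minn x i).1.
Proof. by rewrite /= ltnS geq_minr. Qed.

(** Truncating at [i] makes the function total, so that [cell w l] is directly a sequence for
    [induced_path]. *)
Definition cell w i x : vertex (stair w) :=
  exist (fun p : nat * nat => p.2 < p.1) (i.+1, minn x i) (cell_proof i x).

Lemma sval_cell w i x : x <= i -> sval (cell w i x) = (i.+1, x).
Proof. by move=> xi /=; rewrite (minn_idPl xi). Qed.

Lemma row_induced_path w l : @induced_path (stair w) l (cell w l).
Proof.
split=> i j il jl; first by move=> /(congr1 sval); rewrite !sval_cell // => -[].
by rewrite /= (minn_idPl il) (minn_idPl jl) /row_adj eqxx /=; lia.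
Qed.

(** * Long induced paths *)

(** A walk by unit steps that never returns to where it was two steps before cannot turn. *)
Lemma monotone_of_unit_steps (x : nat -> nat) L :
  (forall n, n < L -> x n.+1 = (x n).+1 \/ x n = (x n.+1).+1) ->
  (forall n, n.+1 < L -> x n <> x n.+2) ->
  (forall n, n <= L -> x n = x 0 + n) \/ (forall n, n <= L -> x n + n = x 0).
Proof.
elim: L => [|L IHL] step ninj.
  by left=> n; rewrite leqn0 => /eqP ->; rewrite addn0.
have {IHL} : (forall n, n <= L -> x n = x 0 + n) \/ (forall n, n <= L -> x n + n = x 0).
  by apply: IHL => n nL; [apply: step | apply: ninj]; lia.
case: L step ninj => [|L] step ninj mono.
  by have [e|e] := step 0 isT; [left|right] => -[|[|n]] //; lia.
have stepL := step L.+1 (ltnSn _); have := ninj L (ltnSn _).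
case: mono => mono nL; [left|right] => n;
  rewrite leq_eqVlt ltnS => /predU1P[->|/mono //];
  by have := mono L (leqnSn L); have := mono L.+1 (leqnn _); lia.
Qed.

Lemma change_exists (P : nat -> bool) l m b :
  m <= l -> b <= l -> P m -> ~~ P b -> exists2 n, n < l & P n != P n.+1.
Proof.
move=> ml bl Pm Pb; apply: contrapT => noch.
have Pconst n : n <= l -> P n = P 0.
  elim: n => // n IHn nl; rewrite -IHn ?(ltnW nl) //.
  by apply/eqP/negPn/negP => ch; apply: noch; exists n; rewrite // eq_sym.
by move: Pm Pb; rewrite !Pconst // => ->.
Qed.

Section Stair.
Variable w : nat -> bool.
Local Notation G := (stair w).

(* A path meeting several rows contains a vertex of its lowest row joined to
   all its vertices in the other rows, so there are at most two of these. *)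
Lemma induced_path_in_row l L (q : nat -> vertex G) :
  induced_path l q -> L.*2 + 3 <= l ->
  exists c i, c + L <= l /\ forall n, n <= L -> (sval (q (c + n))).1 = i.
Proof.
move=> [_ q_adj] lL; pose r n := (sval (q n)).1.
have [m ml m_min] := @minimal_exists nat r (fun n => n <= l) 0 (leq0n l).
have [all_m|] := pselect (forall n, n <= l -> r n = r m).
  exists 0, (r m); split=> [|n nL]; first by lia.
  by apply: all_m; lia.
move=> /existsNP[b /not_implyP[bl /eqP rb]].
have [n nl] := @change_exists (fun n => r n == r m) l m b ml bl (eqxx _) rb.
(* [u] and [v] are consecutive on the path, with [u] in the lowest row and [v] above it; their
   adjacency forces the letter of [u] to be true. *)
move=> r_change; have [u [v [ul vl uv ru rv]]] :
    exists u v, [/\ u <= l, v <= l, u = v.+1 \/ v = u.+1, r u = r m & r v <> r m].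
  move: r_change.
  case: (eqVneq (r n) (r m)) => rn; case: (eqVneq (r n.+1) (r m)) => rn1 // _.
    by exists n, n.+1; split=> //; [exact: ltnW | right | exact/eqP].
  by exists n.+1, n; split=> //; [exact: ltnW | left | exact/eqP].
have cross k : k <= l -> r k <> r m -> row_adj w (sval (q u)) (sval (q k)) = w (sval (q u)).2.
  move=> kl rk; have := m_min k kl; move: rk ru; rewrite /r /row_adj => rk ru rmk.
  by rewrite ifF ?ifT //; lia.
have wu : w (sval (q u)).2.
  by rewrite -(cross v) //; have [_ ] := q_adj u v ul vl; apply.
have out k : k <= l -> r k <> r m -> u = k.+1 \/ k = u.+1.
  by move=> kl rk; apply/(q_adj u k ul kl); rewrite /= cross.
(* Only the indices next to [u] may leave the row; [2L + 3] leaves [L + 1] consecutive other indices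
   before or after them. *)
have [uL|uL] := leqP L.+2 u.
  exists 0, (r m); split=> [|k kL]; first by lia.
  by apply: contrapT => /out; lia.
exists u.+2, (r m); split=> [|k kL]; first by lia.
by apply: contrapT => /out; lia.
Qed.

(** Within a row adjacency gives unit steps and injectivity forbids turning. The bound [L <= a]
    keeps [a - n] from truncating. *)
Lemma induced_path_interval l L (q : nat -> vertex G) :
  induced_path l q -> L.*2 + 3 <= l ->
  exists c i a, c + L <= l /\
    ((forall n, n <= L -> sval (q (c + n)) = (i, a + n)) \/
     (L <= a /\ forall n, n <= L -> sval (q (c + n)) = (i, a - n))).
Proof.
move=> q_path lL; have [c [i [cL qi]]] := induced_path_in_row q_path lL.
case: q_path => q_inj q_adj; pose x n := (sval (q (c + n))).2.
have qE n : n <= L -> sval (q (c + n)) = (i, x n).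
  by move=> nL; rewrite -(qi n nL) -surjective_pairing.
exists c, i, (x 0); split=> //.
have [||up|down] := @monotone_of_unit_steps x L.
- move=> n nL; have [_ /(_ (or_intror (addnS c n)))] :=
    q_adj (c + n) (c + n.+1) ltac:(lia) ltac:(lia).
  by rewrite /= /row_adj (qE n (ltnW nL)) (qE n.+1 nL) /= eqxx; lia.
- move=> n nL xn; have := q_inj (c + n) (c + n.+2) ltac:(lia) ltac:(lia).
  suff -> : q (c + n) = q (c + n.+2) by move=> /(_ erefl); lia.
  by apply: sval_injective; rewrite !qE ?xn //; lia.
- by left=> n nL; rewrite qE // up.
- right; split=> [|n nL]; first by have := down L (leqnn L); lia.
  by rewrite qE // -(down n nL) addnK.
Qed.

Lemma has_unbounded_paths_stair : has_unbounded_paths G.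
Proof. by apply/has_unbounded_pathsP => n; exists (cell w n); exact: row_induced_path. Qed.

Lemma has_unbounded_paths_intervals (A : set (vertex G)) :
  has_unbounded_paths (induced A) -> forall L, exists i a, forall n, n <= L ->
    exists v : vertex (induced A), sval (sval v) = (i, a + n).
Proof.
move=> /has_unbounded_pathsP pA L; have [q q_path] := pA (L.*2 + 3).
have sq_path := @induced_path_embed (induced A) G _ q sval
  (@sval_injective _ A) (fun _ _ => iff_refl _) q_path.
have [c [i [a [_ [up|[aL down]]]]]] := induced_path_interval sq_path (leqnn _).
  by exists i, a => n /up qn; exists (q (c + n)).
exists i, (a - L) => n nL; exists (q (c + (L - n))).
by have /= -> := down (L - n) (leq_subr _ _); congr pair; lia.
Qed.

(** * Path-minimality *)

(** Recurrence is asked of prefixes only, as every factor lies in a prefix. *)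
Definition uniformly_recurrent : Prop := forall N, exists M, forall b,
  exists2 o, o + N <= M & forall n, n < N -> w (b + o + n) = w n.

Lemma path_minimal_stair : uniformly_recurrent -> path_minimal G.
Proof.
move=> w_rec; split=> [|A pA]; first exact: has_unbounded_paths_stair.
have row_ex (Nk : nat * nat) : exists ib : nat * nat, Nk.1 < ib.1 /\
    forall n, n < Nk.2 -> w (ib.2 + n) = w n /\
      exists v : vertex (induced A), sval (sval v) = (ib.1, ib.2 + n).
  case: Nk => N k /=; have [M w_win] := w_rec k.
  (* [M] positions secure the prefix, and [N] more force the row index above [N], since positions
     stay below their row index. *)
  have [i [a A_int]] := has_unbounded_paths_intervals pA (M + N).
  have [o oM wo] := w_win a; exists (i, a + o) => /=; split.
    by have [[v _] /= vE] := A_int _ (leqnn _); have := svalP v; rewrite vE /=; lia.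
  move=> n nk; split; first exact: wo.
  by rewrite -addnA; apply: A_int; lia.
have [h hE] := choice row_ex.
(* Rows are chosen greedily in increasing order; row [j] of [G] is translated into row [(R j).1] by
   [(R j).2], where [A] holds the first [j] letters. *)
pose R := fix R j := if j is j'.+1 then h ((R j').1, j'.+1) else h (0, 0).
have R_homo : {homo (fun j => (R j).1) : i j / i < j}.
  by apply: ltn_step_homo => j; have [] := hE ((R j).1, j.+1).
have RE j n : n < j -> w ((R j).2 + n) = w n /\
    exists v : vertex (induced A), sval (sval v) = ((R j).1, (R j).2 + n).
  by case: j => // j; have [_] := hE ((R j).1, j.+1); apply.
have img_ex (u : vertex G) : exists v : vertex (induced A),
    sval (sval v) = ((R (sval u).1).1, (R (sval u).1).2 + (sval u).2).
  by have [] := RE _ _ (svalP u).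
have [f fE] := choice img_ex.
have R_lt i j : ((R i).1 < (R j).1) = (i < j).
  by have := R_homo i j; have := R_homo j i; case: (ltngtP i j) => [||->]; lia.
apply/embedsP; exists f => [u v fuv|u v].
  apply: sval_injective; have := fE u; rewrite fuv fE => -[].
  have := R_lt (sval u).1 (sval v).1; have := R_lt (sval v).1 (sval u).1.
  move: (sval u) (sval v) => [i x] [j y] /= ltji ltij Rij.
  have ij : i = j by lia.
  by rewrite ij => /addnI ->.
rewrite /= !fE; suff -> : row_adj w (sval u) (sval v) =
  row_adj w ((R (sval u).1).1, (R (sval u).1).2 + (sval u).2)
            ((R (sval v).1).1, (R (sval v).1).2 + (sval v).2) by [].
have [wu _] := RE _ _ (svalP u); have [wv _] := RE _ _ (svalP v).
by apply: row_adj_map; rewrite /= ?R_lt ?wu ?wv // => ->; lia.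
Qed.

(** * Failure of primality *)

(** At most [j * j] vertices lie in rows below [j], so an injective sequence must leave them. *)
Lemma injective_rows_unbounded (h : nat -> nat * nat) :
  injective h -> (forall n, (h n).2 < (h n).1) ->
  forall j k, exists2 n, k <= n & j <= (h n).1.
Proof.
move=> h_inj h_lt j k; apply: contrapT => h_bnd.
have b1 n : (h (k + n)).1 < j.
  by rewrite ltnNge; apply/negP => jh; apply: h_bnd; exists (k + n); rewrite ?leq_addr.
have b2 n : (h (k + n)).2 < j := ltn_trans (h_lt _) (b1 n).
pose e (n : 'I_(j * j).+1) := (Ordinal (b1 n), Ordinal (b2 n)).
have /leq_card : injective e.
  move=> n m [e1 e2]; apply/val_inj/(@addnI k)/h_inj.
  by move: e1 e2; case: (h _) => ? ?; case: (h _) => ? ? /= -> ->.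
by rewrite card_prod !card_ord ltnn.
Qed.

(* In any [H] between two copies of [G] the vertices lying in rows [>= j] form
   a module. *)
Lemma equimorphic_stair_not_prime (H : graph) :
  equimorphic H G -> ~ prime_graph H.
Proof.
move=> [/embedsP[f f_inj f_adj] /embedsP[g g_inj g_adj]] [_ H_prime].
pose h n := sval (f (g (cell w n 0))).
have h_inj : injective h.
  by move=> m n /sval_injective/f_inj/g_inj /(congr1 sval) [].
have h_lt n : (h n).2 < (h n).1 := svalP (f (g (cell w n 0))).
(* This [j] keeps one vertex out of [M], while [n1] and [n2] provide two in it, so [M] is
   nontrivial. *)
pose j := (h 0).1.+1; pose M : set (vertex H) := [set v | j <= (sval (f v)).1].
have [n1 _ jn1] := injective_rows_unbounded h_inj h_lt j 0.
have [n2 lt_n12 jn2] := injective_rows_unbounded h_inj h_lt j n1.+1.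
have M_mod : is_module M.
  (* A vertex outside [M] is sent to a row below all those of [M], so its own letter decides its
     adjacencies to [M]. *)
  move=> v /negP; rewrite -ltnNge => vj.
  have vM a : M a -> adj v a <-> w (sval (f v)).2.
    move=> ja; have lt_va : (sval (f v)).1 < (sval (f a)).1 := leq_trans vj ja.
    by rewrite f_adj /= /row_adj ltn_eqF // lt_va.
  by case wv: (w (sval (f v)).2); [left|right] => a /vM; rewrite wv // => ->.
have [M0|[x Mx]|MT] := H_prime M M_mod.
- by have : M (g (cell w n1 0)) by []; rewrite M0.
- have : h n1 = h n2.
    have : M (g (cell w n1 0)) by []; have : M (g (cell w n2 0)) by [].
    by rewrite Mx /h => -> ->.
  by move=> /h_inj; lia.
- have : M (g (cell w 0 0)) by rewrite MT.
  by rewrite /M /= /j /h; lia.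
Qed.

End Stair.

(** * Well-quasi-ordering of the age *)

(** A pair is the start and the length of an interval of positions, standing for the factor of [w]
    read there. *)
Definition factor_le (w : nat -> bool) (p q : nat * nat) : Prop :=
  exists2 o, o + p.2 <= q.2 & forall n, n < p.2 -> w (p.1 + n) = w (q.1 + o + n).

Lemma factor_le_trans w p q r : factor_le w p q -> factor_le w q r -> factor_le w p r.
Proof.
move=> [o oq wo] [o' o'r wo']; exists (o' + o) => [|n np]; first by lia.
by rewrite wo // -addnA wo' ?addnA //; lia.
Qed.

(* A factor lies in every long enough factor, and there are finitely many
   factors of bounded length. *)
Lemma wqo_factor_le w : uniformly_recurrent w -> wqo (factor_le w).
Proof.
(* The prefix ends where [f 0] ends, so every factor of length at least [M] contains [f 0]. *)
move=> w_rec f; have [M w_win] := w_rec ((f 0).1 + (f 0).2).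
have [[j [j_gt0 Mj]]|short] := pselect (exists j, 0 < j /\ M <= (f j).2).
  exists 0, j; split=> //; have [o oM wo] := w_win (f j).1.
  exists (o + (f 0).1) => [|n n_lt]; first by lia.
  by rewrite -(wo ((f 0).1 + n)); [congr w; lia | lia].
have f_lt n : (f n.+1).2 < M.
  by rewrite ltnNge; apply/negP => Mf; apply: short; exists n.+1.
pose c n := (Ordinal (f_lt n), [ffun k : 'I_M => w ((f n.+1).1 + k)]).
pose N := #|{: 'I_M * {ffun 'I_M -> bool}}|.
have /injectivePn[i [j ij cij]] : ~~ injectiveb (fun n : 'I_N.+1 => c n).
  by apply/injectiveP => /leq_card; rewrite card_ord ltnn.
have same n m : c n = c m -> factor_le w (f n.+1) (f m.+1).
  move=> [e2 /ffunP ew]; exists 0; rewrite ?add0n ?e2 // => k k_lt.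
  have kM : k < M by apply: ltn_trans k_lt _; rewrite -e2.
  by have := ew (Ordinal kM); rewrite !ffunE /= addn0.
have [lt_ij|lt_ji|/val_inj eq_ij] := ltngtP i j.
- by exists i.+1, j.+1; split; [|exact: same].
- by exists j.+1, i.+1; split; [|exact: same].
- by rewrite eq_ij eqxx in ij.
Qed.

(** When [P x] holds, this is the start of the maximal run containing [x]. *)
Fixpoint run_start (P : nat -> bool) (x : nat) : nat :=
  if x is x'.+1 then if P x' then run_start P x' else x else 0.

Lemma run_start_le P x : run_start P x <= x.
Proof. by elim: x => //= x IHx; case: ifP => // _; exact: leqW. Qed.

(** One equation covers both cases: [L j] is the length of the maximal run starting at [j], or 0 if
    none starts there. *)
Definition run_lengths (P : nat -> bool) (L : nat -> nat) : Prop :=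
  forall j n, (P (j + n) && (run_start P (j + n) == j)) = (n < L j).

Lemma run_lengths_exists (P : nat -> bool) N :
  (forall x, P x -> x < N) -> exists L, run_lengths P L.
Proof.
move=> P_lt.
suff /choice[L LE] : forall j, exists l, forall n,
  (P (j + n) && (run_start P (j + n) == j)) = (n < l) by exists L.
move=> j; pose Q n := P (j + n) && (run_start P (j + n) == j).
have Q_down n : Q n.+1 -> Q n.
  rewrite /Q addnS /=; case: (P (j + n)) => /andP[_ //] /eqP; lia.
have exQ : exists n, ~~ Q n.
  by exists N; apply/negP => /andP[/P_lt]; lia.
have [l Ql l_min] := ex_minnP exQ; exists l => n; rewrite -/(Q n).
have [nl|ln] := ltnP n l.
  by apply: contraLR nl; rewrite -leqNgt; exact: l_min.
apply/negbTE; rewrite -(subnKC ln); elim: (n - l) => [|k]; first by rewrite addn0.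
by rewrite addnS; apply: contra; exact: Q_down.
Qed.

Lemma homo_ltn_inj (g : nat -> nat) : {homo g : i j / i < j} -> injective g.
Proof.
by move=> g_homo i j gij; have := g_homo i j; have := g_homo j i; rewrite gij; lia.
Qed.

(** Each run of [P] is translated into a run of [P'], distinct runs into distinct ones. As runs of
    [P'] are maximal, consecutive images come from a single run. *)
Lemma row_embedding w (P P' : nat -> bool) (L L' : nat -> nat) (g : nat -> nat) N :
  (forall x, P x -> x < N) -> run_lengths P L -> run_lengths P' L' ->
  {homo g : i j / i < j} ->
  (forall j, j < N -> factor_le w (j, L j) (g j, L' (g j))) ->
  exists F : nat -> nat,
    (forall x, P x -> P' (F x) /\ w x = w (F x)) /\
    (forall x y, P x -> P y ->
       (F x = F y -> x = y) /\ (x = y.+1 <-> F x = (F y).+1)).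
Proof.
move=> P_lt PL PL' g_homo gR.
have o_ex j : exists o, j < N ->
    o + L j <= L' (g j) /\ forall n, n < L j -> w (j + n) = w (g j + o + n).
  have [/gR[o ? ?]|] := ltnP j N; first by exists o.
  by exists 0.
have [o oE] := choice o_ex; pose st := run_start P.
have stx x : st x <= x := run_start_le P x.
have lenx x : P x -> x - st x < L (st x).
  by move=> Px; rewrite -PL subnKC // Px eqxx.
pose F x := g (st x) + (o (st x) + (x - st x)).
have FP x : P x -> [/\ P' (F x), run_start P' (F x) = g (st x) & w x = w (F x)].
  move=> Px; have [oL ow] := oE (st x) (leq_ltn_trans (stx x) (P_lt x Px)).
  have : o (st x) + (x - st x) < L' (g (st x)).
    by apply: leq_trans oL; rewrite ltn_add2l lenx.
  rewrite -PL' => /andP[P'F /eqP stF]; split=> //.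
  by rewrite /F addnA -ow ?subnKC // lenx.
have g_inj := homo_ltn_inj g_homo.
exists F; split=> [x /FP[]//|x y Px Py].
have [P'x stFx _] := FP x Px; have [P'y stFy _] := FP y Py.
have := stx x; have := stx y.
split=> [Fxy|].
  have stxy : st x = st y by apply: g_inj; rewrite -stFx -stFy Fxy.
  by move: Fxy (stx x); rewrite /F stxy; lia.
split=> [xy|Fxy].
  have stxy : st x = st y by rewrite xy /st /= Py.
  by rewrite /F stxy; lia.
have stxy : st x = st y by apply: g_inj; rewrite -stFx -stFy Fxy /= P'y.
by move: Fxy (stx x); rewrite /F stxy; lia.
Qed.

Section AgeWqo.
Variable w : nat -> bool.
Local Notation G := (stair w).

(* [c] lists, row by row, the maximal intervals (start, length) of the image
   of [H]; positions that start no interval contribute length [0]. *)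
Definition codes (c : seq (seq (nat * nat))) (H : graph) : Prop :=
  exists (f : vertex H -> vertex G) (N : nat) (P : nat -> nat -> bool)
    (L : nat -> nat -> nat),
  [/\ injective f /\ (forall x y, adj x y <-> adj (f x) (f y)),
      forall i x, P i x <-> exists v, sval (f v) = (i, x),
      forall i x, P i x -> i < N /\ x < N,
      forall i, run_lengths (P i) (L i)
    & c = mkseq (fun i => mkseq (fun j => (j, L i j)) N) N].

Lemma codes_exist (H : graph) : age G H -> exists c, codes c H.
Proof.
move=> [H_fin /embedsP[f f_inj f_adj]].
have [N f_lt] : exists N, forall v, (sval (f v)).1 < N.
  have /finite_seqP[s sE] := finite_image (fun v => (sval (f v)).1) H_fin.
  exists (\max_(i <- s) i).+1 => v; rewrite ltnS.
  suff : (sval (f v)).1 \in s by move=> vs; exact: leq_bigmax_seq.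
  have : ((fun v => (sval (f v)).1) @` [set: vertex H]) (sval (f v)).1 by exists v.
  by rewrite sE.
pose P i x := `[< exists v, sval (f v) = (i, x) >].
have P_lt i x : P i x -> i < N /\ x < N.
  move=> /asboolP[v vE]; have := f_lt v; have := svalP (f v).
  by rewrite vE /=; lia.
have L_ex i : exists L, run_lengths (P i) L.
  by apply: (@run_lengths_exists _ N) => x /P_lt[].
have [L LE] := choice L_ex.
exists (mkseq (fun i => mkseq (fun j => (j, L i j)) N) N), f, N, P, L.
by split=> // i x; split=> [/asboolP|?]; last apply/asboolP.
Qed.

(** The outer embedding preserves the order of rows; the inner ones preserve letters and adjacency
    within a row. [row_adj] depends on nothing else. *)
Lemma codes_embeds c c' H H' : codes c H -> codes c' H' ->
  word_embeds (word_embeds (factor_le w)) c c' -> embeds H H'.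
Proof.
move=> [f [N [P [L [[f_inj f_adj] PE P_lt PL ->]]]]].
move=> [f' [N' [P' [L' [[f'_inj f'_adj] P'E P'_lt PL' ->]]]]] [g g_homo gR].
have F_ex i : exists F : nat -> nat,
    (forall x, P i x -> P' (g i) (F x) /\ w x = w (F x)) /\
    (forall x y, P i x -> P i y ->
       (F x = F y -> x = y) /\ (x = y.+1 <-> F x = (F y).+1)).
  have [iN|Ni] := ltnP i N; last first.
    by exists id; split=> [x|x y] /P_lt; lia.
  have := gR [::] i; rewrite !size_mkseq => /(_ iN)[giN'].
  rewrite !nth_mkseq // => -[h h_homo hR].
  apply: (@row_embedding w _ _ (L i) (L' (g i)) h N) => // [x /P_lt[] //|j jN].
  have := hR (0, 0) j; rewrite !size_mkseq => /(_ jN)[hjN'].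
  by rewrite !nth_mkseq.
have [F FE] := choice F_ex.
have Pf v : P (sval (f v)).1 (sval (f v)).2.
  by apply/PE; exists v; rewrite -surjective_pairing.
have img_ex v : exists v', sval (f' v') =
    (g (sval (f v)).1, F (sval (f v)).1 (sval (f v)).2).
  by apply/P'E; have [/(_ _ (Pf v))[]] := FE (sval (f v)).1.
have [e eE] := choice img_ex.
have g_inj := homo_ltn_inj g_homo.
have g_lt i j : (g i < g j) = (i < j).
  by have := g_homo i j; have := g_homo j i; case: (ltngtP i j) => [||->]; lia.
apply/embedsP; exists e => [u v euv|u v].
  apply/f_inj/sval_injective; have := eE u; rewrite euv eE => -[].
  move: (Pf u) (Pf v); case: (sval (f u)) => i x; case: (sval (f v)) => j y /=.
  move=> Pix Pjy /g_inj ji; rewrite ji in Pjy *.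
  by have [_ /(_ _ _ Pjy Pix)[inj _]] := FE i; move/inj ->.
rewrite f_adj f'_adj /= !eE; move: (Pf u) (Pf v).
case: (sval (f u)) => i x; case: (sval (f v)) => j y /= Pix Pjy.
suff -> : row_adj w (i, x) (j, y) = row_adj w (g i, F i x) (g j, F j y) by [].
have [FEi _] := FE i; have [_ wx] := FEi x Pix.
have [FEj _] := FE j; have [_ wy] := FEj y Pjy.
apply: row_adj_map; rewrite /= ?g_lt // => ij; subst j;
  have [_ Fadj] := FE i.
  by have [] := Fadj _ _ Pix Pjy.
by have [] := Fadj _ _ Pjy Pix.
Qed.

Lemma well_quasi_ordered_age_stair :
  uniformly_recurrent w -> well_quasi_ordered (age G).
Proof.
move=> w_rec [A [A_age /infiniteP A_inf A_anti]].
have [h h_inj hA] : exists2 h : nat -> graph, injective h & forall n, A (h n).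
  have /card_leP[h] := A_inf; pose x n := exist (fun m => m \in [set: nat]) n (mem_setT n).
  exists (fun n => set_val (h (x n))) => [m n|n]; last exact: set_valP.
  by move=> /val_inj/(@inj _ _ _ h)-/(_ _ _)/(congr1 val)/=; apply; rewrite inE.
have c_ex n : exists c, codes c (h n) by apply/codes_exist/A_age.
have [c cE] := choice c_ex.
have c_wqo : wqo (word_embeds (word_embeds (factor_le w))).
  apply: higman; first exact: (word_embeds_trans (@factor_le_trans w)).
  by apply: higman; [exact: factor_le_trans | exact: wqo_factor_le].
have [i [j [ij cij]]] := c_wqo c.
apply: (A_anti (h i) (h j)) => //; last exact: codes_embeds cij.
by move=> /h_inj; lia.
Qed.

End AgeWqo.

(** * Recovering the word from the age *)

(* A row of [stair (toeplitz s)] together with one vertex of a later row spells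
   a factor of [toeplitz s]: that vertex sees exactly the letters [true]. *)
Lemma age_stair_factors s s' L : no_triple s ->
  age (stair (toeplitz s)) `<=` age (stair (toeplitz s')) ->
  exists c a, (forall n, n <= L -> toeplitz s' (a + n) = toeplitz s (c + n)) \/
    (L <= a /\ forall n, n <= L -> toeplitz s' (a - n) = toeplitz s (c + n)).
Proof.
move=> s_nt sub_age.
(* The window must hold the indices [nt], [nf] and [nt + 8], all below 16. *)
wlog L16 : L / 16 <= L => [wlogL|].
  have [c [a [up|[aL down]]]] := wlogL (L + 16) (leq_addl _ _).
    by exists c, a; left=> n nL; apply: up; lia.
  by exists c, a; right; split=> [|n nL]; [lia | apply: down; lia].
set w := toeplitz s in sub_age *; set w' := toeplitz s' in sub_age *.
pose l := L.*2 + 3.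
pose A : set (vertex (stair w)) := (cell w l @` `I_l.+1) `|` [set cell w l.+1 0].
have Aq n : A (cell w l n).
  left; exists (minn n l); first by rewrite /= ltnS geq_minr.
  by apply: sval_injective; rewrite /= -minnA minnn.
pose v0 : vertex (induced A) := exist A (cell w l.+1 0) (or_intror erefl).
pose q0 n : vertex (induced A) := exist A (cell w l n) (Aq n).
have A_fin : finite_graph (induced A).
  have A_fin : finite_set A.
    by rewrite finite_setU; split; [exact/finite_image/finite_II | exact: finite_set1].
  rewrite /finite_graph (_ : [set: _] = @sval _ A @^-1` A).
    by apply: finite_preimage => // x y _ _; exact: sval_injective.
  by apply/seteqP; split=> v // _; exact: svalP.
have [_ /embedsP[f f_inj f_adj]] : age (stair w') (induced A).
  apply: sub_age; split=> //; apply/embedsP.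
  by exists sval; [exact: sval_injective | ].
have q0_path : induced_path l q0.
  have [c_inj c_adj] := row_induced_path w l.
  split=> i j il jl; last exact: c_adj.
  by move=> /(congr1 sval); exact: c_inj.
have q_path := induced_path_embed f_inj f_adj q0_path.
have [c [i [a [cl q_int]]]] := induced_path_interval q_path (leqnn _).
exists c, a; case vE: (sval (f v0)) => [k y].
have v_adj n : n <= l -> row_adj w' (k, y) (sval (f (q0 n))) = w n.
  move=> nl; have := f_adj v0 (q0 n); rewrite /= vE (minn_idPl nl).
  rewrite /row_adj /= gtn_eqF // ltnNge leqnSn /=.
  by move=> [? ?]; apply/idP/idP.
have vals b : exists2 n, n < 8 & forall m, w (c + n + 8 * m) = b.
  exact: toeplitz_value.
have [nt nt8 wt] := vals true; have [nf nf8 wf] := vals false.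
have q_row n : n <= L -> (sval (f (q0 (c + n)))).1 = i.
  by case: q_int => [up|[_ down]] nL; [rewrite up | rewrite down].
(* From a lower row [v0] would see all or none of the interval, yet both letters occur there. *)
have not_lt : ~~ (k < i).
  apply/negP => ki; have at_n n : n <= L -> w (c + n) = w' y.
    by move=> nL; rewrite -v_adj ?/row_adj ?q_row /= ?ltn_eqF ?ki //; lia.
  have := wt 0; have := wf 0; rewrite !muln0 !addn0 !at_n; [|lia..].
  by move=> ->.
(* Within the same row [v0] would be next to two vertices at distance 8. *)
have not_eq : k != i.
  apply/eqP => ki; have near n : n <= L -> w (c + n) ->
      y = (sval (f (q0 (c + n)))).2.+1 \/ (sval (f (q0 (c + n)))).2 = y.+1.
    by move=> nL; rewrite -v_adj ?/row_adj ?q_row /= ?ki ?eqxx //; lia.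
  have w0 : w (c + nt) by have := wt 0; rewrite muln0 addn0.
  have w1 : w (c + (nt + 8)) by rewrite addnA -[X in _ + X]muln1 wt.
  have := near nt ltac:(lia) w0; have := near (nt + 8) ltac:(lia) w1.
  have [nt1 nt2] : nt <= L /\ nt + 8 <= L by lia.
  case: q_int => [up|[aL down]]; first by rewrite (up _ nt1) (up _ nt2) /=; lia.
  by rewrite (down _ nt1) (down _ nt2) /=; lia.
have spell n : n <= L -> w' (sval (f (q0 (c + n)))).2 = w (c + n).
  move=> nL; have cnl : c + n <= l by lia.
  by rewrite -(v_adj _ cnl) /row_adj (q_row _ nL) /= (negbTE not_eq) (negbTE not_lt).
case: q_int => [up|[aL down]].
  by left=> n nL; rewrite -spell // up.
by right; split=> // n nL; rewrite -spell // down.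
Qed.

Lemma age_stair_inj s s' : no_triple s ->
  age (stair (toeplitz s)) `<=` age (stair (toeplitz s')) -> s' =1 s.
Proof.
move=> s_nt sub_age; apply: toeplitz_factors_inj => // L.
have [c [a [up|[aL down]]]] := age_stair_factors L s_nt sub_age.
  by exists a.+1, c.+1; split=> // m /up; rewrite /toeplitz -!addSn.
(* A descending occurrence is turned round by the reflection of [toeplitz_rev], with a power of 2
   exceeding [a.+1]. *)
have a_lt : a.+1 < 2 ^ a.+1 by exact: ltn_expl.
exists (2 ^ a.+1 - a.+1), c.+1; split=> // [|m mL]; first by lia.
have := down m mL; rewrite -(@toeplitz_rev s' a.+1); last by lia.
rewrite /toeplitz -addSn => <-; congr (s' (logn 2 _)); lia.
Qed.

Theorem theorem11 :
  exists S : set graph,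
    [/\ S #= [set: nat -> bool],
        (forall G : graph, S G -> path_minimal G /\ ~ prime_graph G),
        (forall G H : graph, S G -> S H -> G <> H ->
           ~ (age G `<=` age H) /\ ~ (age H `<=` age G)),
        (forall G : graph, S G -> well_quasi_ordered (age G))
      & (forall G H : graph, S G -> equimorphic H G -> ~ prime_graph H)].
Proof.
pose F t := stair (toeplitz (interleave_neg t)).
(* A single inclusion already forces equality, which yields both incomparability and the cardinality
   of the family. *)
have F_age t t' : age (F t) `<=` age (F t') -> t = t'.
  by move=> /age_stair_inj tt'; apply/interleave_neg_inj/fsym/tt'/no_triple_interleave_neg.
have F_rec t : uniformly_recurrent (toeplitz (interleave_neg t)).
  exact: toeplitz_window.
exists (range F); split.
- by apply: inj_card_eq => t t' _ _ FF; apply: F_age; rewrite FF.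
- move=> _ [t _ <-]; split; first exact: path_minimal_stair.
  have Fid : embeds (F t) (F t) by apply/embedsP; exists id.
  exact: (equimorphic_stair_not_prime (conj Fid Fid)).
- move=> _ _ [t _ <-] [t' _ <-] FF.
  by split=> /F_age tt'; apply: FF; rewrite tt'.
- by move=> _ [t _ <-]; exact: well_quasi_ordered_age_stair.
- by move=> _ H [t _ <-]; exact: equimorphic_stair_not_prime.
Qed.
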